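(* Let $(X, \|\cdot\|_X)$ be a (real) normed space and let $a, b, c \in X$ be three aligned points with $c \notin [a,b]$. Then $$\|a+b-c\|_X \geq \Big| \|a\|_X + \|b\|_X - \|c\|_X \Big|.$$ In particular, if $a,b \in X$ satisfy $\|a\|_X = \|b\|_X$ and $\lambda \in [0,1]$, then $$\|a+\lambda(a-b)\|_X \geq \|b+\lambda(a-b)\|_X.$$
   Context: Points are aligned if they lie on a common (affine) line. For $a,b \in X$, $[a,b] = \{(1-\lambda)a + \lambda b : 0 \leq \lambda \leq 1\}$ denotes the closed segment joining $a$ and $b$. *)

(* Defs.v *)
From HB Require Import structures.
From mathcomp Require Import all_boot all_order all_algebra.
From mathcomp Require Import all_classical all_reals all_analysis.

Set Implicit Arguments.
Unset Strict Implicit.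
Unset Printing Implicit Defensive.

Import Order.TTheory GRing.Theory Num.Theory.
Import numFieldNormedType.Exports.

Local Open Scope classical_set_scope.
Local Open Scope ring_scope.

Definition affine_line (R : realType) (X : lmodType R) (p v : X) : set X :=
  [set x | exists t : R, x = p + t *: v].

(* The direction is required to be nonzero, so that a line is one-dimensional;
   the points themselves need not be distinct. *)
Definition aligned (R : realType) (X : lmodType R) (a b c : X) : Prop :=
  exists p v : X, v != 0 /\ [set a; b; c] `<=` affine_line p v.

Definition closed_segment (R : realType) (X : lmodType R) (a b : X) : set X :=
  [set x | exists l : R, 0 <= l <= 1 /\ x = (1 - l) *: a + l *: b].

(* Main.v *)
(** Convexity of the norm gives [`|c - w| + `|d + w| <= `|c| + `|d|] when [w] is
    a fraction of [c - d], i.e. when two points of the segment [c, d] have the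
    same midpoint as [c, d].  When [c] lies outside [a, b], both [a] and [b] lie
    on the segment joining [c] to [d = a + b - c], so
    [`|a| + `|b| <= `|c| + `|d|]; the other half of the first claim is the
    triangle inequality for [c = a + b - d].  The second claim is the same
    convexity bound for [c = a + l (a - b)], [d = b], [w = l (a - b)]. *)

Require Import Defs.
From HB Require Import structures.
From mathcomp Require Import all_boot all_order all_algebra.
From mathcomp Require Import all_classical all_reals all_analysis.
From mathcomp Require Import ring lra.

Set Implicit Arguments.
Unset Strict Implicit.
Unset Printing Implicit Defensive.

Import Order.TTheory GRing.Theory Num.Theory.
Import numFieldNormedType.Exports.

Local Open Scope classical_set_scope.
Local Open Scope ring_scope.

(** With [m = k / n], the points [c - w] and [d + w] are convex combinations of [c] and [d] with
    swapped weights, so the two convexity bounds add up to the claim. Giving the fraction as a pair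
    [k], [n] leaves callers a division-free equation. *)
Lemma ler_norm_contract (R : realType) (X : normedModType R) (c d w : X)
    (k n : R) :
  0 <= k <= n -> n *: w = k *: (c - d) -> 0 < n ->
  `|c - w| + `|d + w| <= `|c| + `|d|.
Proof.
move=> /andP[k0 kn] nwE n0.
have wE : w = (k / n) *: (c - d).
  by rewrite mulrC -scalerA -nwE scalerA mulVf ?gt_eqF// scale1r.
have m0 : 0 <= k / n by rewrite divr_ge0// ltW.
have m1 : 0 <= 1 - k / n by rewrite subr_ge0 ler_pdivrMr// mul1r.
move: (k / n) m0 m1 wE => m m0 m1 wE.
have cE : c - w = (1 - m) *: c + m *: d.
  by rewrite wE scalerBl scale1r scalerBr opprB addrA addrAC.
have dE : d + w = m *: c + (1 - m) *: d.
  by rewrite wE scalerBl scale1r scalerBr addrCA.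
have := ler_normD ((1 - m) *: c) (m *: d).
have := ler_normD (m *: c) ((1 - m) *: d).
rewrite -cE -dE !normrZ !(ger0_norm m0) !(ger0_norm m1); lra.
Qed.

Lemma ler_normD_aligned (R : realType) (X : normedModType R) (p v : X)
    (s t r : R) :
  0 < (r - s) * (r - t) ->
  `|p + s *: v| + `|p + t *: v| <= `|p + r *: v| + `|p + (s + t - r) *: v|.
Proof.
move=> st.
have subE x y : p + x *: v - (p + y *: v) = (x - y) *: v.
  by rewrite opprD addrACA subrr add0r scalerBl.
have -> : p + s *: v = p + r *: v - (r - s) *: v.
  by rewrite -addrA -scalerBl subKr.
have -> : p + t *: v = p + (s + t - r) *: v + (r - s) *: v.
  by rewrite -addrA -scalerDl; congr (_ + _ *: _); ring.
(* Here [w = (r - s) *: v] and [c - d = ((r - s) + (r - t)) *: v]. Both differences have the same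
   sign; when it is negative, [k] and [n] are negated to keep [n] positive. *)
have [rs|rs] := ltP 0 (r - s).
  apply: (@ler_norm_contract _ _ _ _ _ (r - s) ((r - s) + (r - t))).
  - by apply/andP; split; nra.
  - by rewrite subE !scalerA; congr (_ *: _); ring.
  - nra.
apply: (@ler_norm_contract _ _ _ _ _ (s - r) ((s - r) + (t - r))).
- by apply/andP; split; nra.
- by rewrite subE !scalerA; congr (_ *: _); ring.
- nra.
Qed.

Lemma mem_closed_segment_line (R : realType) (X : lmodType R) (p v : X)
    (s t r : R) :
  (r - s) * (r - t) <= 0 ->
  closed_segment (p + s *: v) (p + t *: v) (p + r *: v).
Proof.
move=> st; have [ts|ts] := eqVneq t s.
  exists 0; split; first by rewrite lexx ler01.
  have -> : r = s by subst t; nra.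
  by rewrite subr0 scale1r scale0r addr0.
have ts0 : t - s != 0 by rewrite subr_eq0.
have lE : (r - s) / (t - s) * (t - s) = r - s by rewrite divfK.
exists ((r - s) / (t - s)); move: lE; set l := _ / _ => lE; split.
  have ts2 : 0 < (t - s) * (t - s) by rewrite -expr2 exprn_even_gt0.
  (* As [r - s = l * (t - s)] and [r - t = (l - 1) * (t - s)], the hypothesis becomes
     [l * (l - 1) <= 0] up to a positive square. *)
  have : l * (l - 1) * ((t - s) * (t - s)) <= 0.
    suff -> : l * (l - 1) * ((t - s) * (t - s)) = (r - s) * (r - t) by [].
    by rewrite -lE; nra.
  rewrite pmulr_lle0// => ll; apply/andP; split; nra.
rewrite !scalerDr !scalerA addrACA -!scalerDl subrK scale1r.
by congr (_ + _ *: _); nra.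
Qed.

Theorem corollary4p2 (R : realType) (X : normedModType R) :
  (forall a b c : X,
     aligned a b c -> c \notin closed_segment a b ->
     `|a + b - c| >= `| `|a| + `|b| - `|c| |) /\
  (forall (a b : X) (l : R),
     `|a| = `|b| -> 0 <= l <= 1 ->
     `|a + l *: (a - b)| >= `|b + l *: (a - b)|).
Proof.
split=> [a b c [p [v [_ line]]] cab|a b l ab /andP[l0 l1]].
  have [s aE] : affine_line p v a by apply: line; left; left.
  have [t bE] : affine_line p v b by apply: line; left; right.
  have [r cE] : affine_line p v c by apply: line; right.
  have str : 0 < (r - s) * (r - t).
    rewrite ltNge; apply/negP => /(mem_closed_segment_line p v).
    by rewrite -aE -bE -cE; move: cab; rewrite notin_setE.
  have dE : a + b - c = p + (s + t - r) *: v.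
    rewrite aE bE cE opprD addrACA [_ - p]addrAC subrr add0r -addrA addrCA.
    by rewrite -scalerBl -scalerDl -[s + t - r]addrA.
  have := ler_normD_aligned p v str; rewrite -dE -aE -bE -cE => abcd.
  have := ler_normB (a + b) (a + b - c); rewrite subKr => cabd.
  have abD := ler_normD a b.
  by rewrite ler_norml; apply/andP; split; lra.
(* Here [c - d = (1 + l) *: (a - b)], so [w] is the fraction [l / (1 + l)] of it. Since [c - w = a],
   the equal norms of [a] and [b] cancel. *)
have := @ler_norm_contract _ _ (a + l *: (a - b)) b (l *: (a - b)) l (1 + l).
rewrite addrK ab [`|b| + _]addrC lerD2r; apply.
- by apply/andP; split; lra.
- by rewrite [a + _ - b]addrAC scalerA mulrC -scalerA scalerDl scale1r.
- lra.
Qed.
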